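(* Let $\mathcal{G}=\{G_n\}_{n\in\mathbb{N}}$ and $\mathcal{H}=\{H_n\}_{n\in\mathbb{N}}$ be coarsely equivalent graph sequences. If one of them has cost $1$, then the other one also has cost $1$; that is, $c(\mathcal{G})=1$ if and only if $c(\mathcal{H})=1$.
   Context: A graph sequence $\mathcal{G}=\{G_n\}_{n\in\mathbb{N}}$ is a sequence of finite connected graphs whose vertex degrees are bounded by a constant $d$ independent of $n$, with $\lim_{n\to\infty}|V(G_n)|=\infty$. Here $V(G)$ and $E(G)$ denote the vertex and edge sets of $G$, and each graph carries its path metric. The edge number is $e(\mathcal{G})=\liminf_{n\to\infty}\frac{|E(G_n)|}{|V(G_n)|}$. For graph sequences write $\mathcal{G}\simeq\mathcal{H}$ if $V(G_n)=V(H_n)$ for all $n$ and there is $L>0$ (independent of $n$) such that for all $n$ the identity map $V(G_n)\to V(H_n)$ is $L$-bi-Lipschitz for the path metrics. The cost is $c(\mathcal{G})=\inf\{e(\mathcal{H}) : \mathcal{H}\text{ a graph sequence},\ \mathcal{H}\simeq\mathcal{G}\}$. An $(A,A)$-quasi-isometry between metric spaces $X,X'$ is a map $f:X\to X'$ with $\frac{d(x,y)}{A}-A\le d(f(x),f(y))\le A\,d(x,y)+A$ for all $x,y\in X$ and such that every $x'\in X'$ satisfies $d(x',f(x))\le A$ for some $x\in X$. Graph sequences $\mathcal{G},\mathcal{H}$ are coarsely equivalent if there is a constant $A$ such that for every $n\in\mathbb{N}$ there exists an $(A,A)$-quasi-isometry $\phi_n:G_n\to H_n$ (between vertex sets with path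 metrics). *)

(* Defs.v *)
From mathcomp Require Import all_boot all_order all_algebra.
From mathcomp Require Import all_classical all_reals all_analysis.

Set Implicit Arguments.
Unset Strict Implicit.
Unset Printing Implicit Defensive.

Import Order.TTheory GRing.Theory Num.Theory.

Local Open Scope classical_set_scope.
Local Open Scope ring_scope.

(* Finite connected simple graph on the vertex set V (nonempty, as usual for
   connected graphs). *)
Record cgraph (V : finType) := CGraph {
  adj :> rel V;
  adj_sym : symmetric adj;
  adj_irrefl : irreflexive adj;
  vertices_gt0 : (0 < #|V|)%N;
  adj_connected : forall x y : V, connect adj x y
}.

Definition edges (V : finType) (G : cgraph V) : {set {set V}} :=
  [set [set p.1; p.2]%SET | p : V * V & G p.1 p.2]%SET.

Definition degree (V : finType) (G : cgraph V) (x : V) : nat :=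
  #|[set y | G x y]%SET|.

Definition has_walk (V : finType) (G : cgraph V) (x y : V) (k : nat) : bool :=
  [exists p : k.-tuple V, path G x p && (last x p == y)].

Lemma ex_walk (V : finType) (G : cgraph V) (x y : V) :
  exists k, has_walk G x y k.
Proof.
have /connectP[p Gp ->] := adj_connected G x y.
by exists (size p); apply/existsP; exists (in_tuple p); rewrite /= Gp eqxx.
Qed.

Definition gdist (V : finType) (G : cgraph V) (x y : V) : nat :=
  ex_minn (ex_walk G x y).

Definition bilipschitz (R : realType) (L : R) (V W : finType)
    (G : cgraph V) (H : cgraph W) (f : V -> W) : Prop :=
  forall x y : V, (gdist G x y)%:R / L <= (gdist H (f x) (f y))%:R :> R
                  /\ (gdist H (f x) (f y))%:R <= L * (gdist G x y)%:R.

Definition quasi_isometry (R : realType) (A : R) (V W : finType)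
    (G : cgraph V) (H : cgraph W) (f : V -> W) : Prop :=
  (forall x y : V, (gdist G x y)%:R / A - A <= (gdist H (f x) (f y))%:R :> R
                   /\ (gdist H (f x) (f y))%:R <= A * (gdist G x y)%:R + A)
  /\ (forall z : W, exists x : V, (gdist H z (f x))%:R <= A).

Record graph_sequence (V : nat -> finType) := GraphSequence {
  graph_of :> forall n, cgraph (V n);
  bounded_degree : exists d : nat, forall n x, (degree (graph_of n) x <= d)%N;
  vertices_cvg : #|V n| @[n --> \oo] --> \oo
}.

Definition edge_number (R : realType) (V : nat -> finType)
    (G : graph_sequence V) : \bar R :=
  limn_einf (fun n => (#|edges (G n)|%:R / #|V n|%:R)%:E).

(* The equality of the vertex sets is enforced by the shared index V. *)
Definition bilip_equivalent (R : realType) (V : nat -> finType)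
    (G H : graph_sequence V) : Prop :=
  exists2 L : R, 0 < L & forall n, bilipschitz L (G n) (H n) id.

Definition cost (R : realType) (V : nat -> finType) (G : graph_sequence V) :
    \bar R :=
  ereal_inf [set edge_number R H | H in [set H | bilip_equivalent R H G]].

Definition coarsely_equivalent (R : realType) (V W : nat -> finType)
    (G : graph_sequence V) (H : graph_sequence W) : Prop :=
  exists2 A : R, 0 < A &
    forall n, exists phi : V n -> W n, quasi_isometry A (G n) (H n) phi.

(* Main.v *)
(* A connected graph has at least as many edges as vertices minus one, so every
   cost is at least 1.  Conversely let [phi : G -> H] be a quasi-isometry and
   let [G'] be bi-Lipschitz to [G].  Choose a set [S] with one vertex in each
   fibre of [phi]; it is uniformly dense in [G'], so [G'] has a spanning forest
   of bounded depth rooted at [S].  Contract each tree to its root, transport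
   the result to the image of [phi], and attach every other vertex of [H] to a
   nearby vertex of that image.  The resulting [H'] is bi-Lipschitz to [H], and
   [|E(H')| - |W| <= |E(G')| - |V|], because the contraction kills at least
   [|V| - |S|] edges.  As [|V| / |W|] is bounded by a constant depending only
   on [G] and [phi], an edge number of [G'] close to 1 forces one of [H'] close
   to 1. *)

Require Import Defs.
From mathcomp Require Import all_boot all_order all_algebra.
From mathcomp Require Import all_classical all_reals all_analysis.
From mathcomp Require Import zify lra.

Set Implicit Arguments.
Unset Strict Implicit.
Unset Printing Implicit Defensive.

Import Order.TTheory GRing.Theory Num.Theory.

(** * The path metric and the growth of balls *)

Section GraphDistance.
Variables (V : finType) (G : cgraph V).
Implicit Types x y z : V.

Lemma gdist_walk x y :
  exists p, [/\ path G x p, last x p = y & size p = gdist G x y].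
Proof.
rewrite /gdist; case: ex_minnP => k /existsP[p /andP[Gp /eqP px]] _.
by exists p; rewrite size_tuple.
Qed.

Lemma gdist_le_size x p : path G x p -> gdist G x (last x p) <= size p.
Proof.
move=> Gp; rewrite /gdist; case: ex_minnP => k _; apply.
by apply/existsP; exists (in_tuple p); rewrite /= Gp eqxx.
Qed.

Lemma gdistxx x : gdist G x x = 0.
Proof. by apply/eqP; rewrite -leqn0; exact: (@gdist_le_size x [::]). Qed.

Lemma gdist_eq0 x y : gdist G x y = 0 -> x = y.
Proof.
by have [p [_ <- <-]] := gdist_walk x y; move/size0nil => ->.
Qed.

Lemma gdist_adj x y : G x y -> gdist G x y <= 1.
Proof. by move=> xy; apply: (@gdist_le_size x [:: y]); rewrite /= xy. Qed.

Lemma gdist_triangle y x z : gdist G x z <= gdist G x y + gdist G y z.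
Proof.
have [p [Gp py <-]] := gdist_walk x y; have [q [Gq qz <-]] := gdist_walk y z.
rewrite -size_cat -qz -py -last_cat; apply: gdist_le_size.
by rewrite cat_path Gp py.
Qed.

Lemma gdist_step x y :
  x != y -> exists2 u, G x u & gdist G u y < gdist G x y.
Proof.
have [[|u p] [/= Gp <- <-]] := gdist_walk x y; first by rewrite eqxx.
by case/andP: Gp => xu Gp _; exists u => //; rewrite ltnS gdist_le_size.
Qed.

End GraphDistance.

Lemma gdist_lipschitz (V W : finType) (G : cgraph V) (H : cgraph W)
    (f : V -> W) (c : nat) :
    (forall x y, G x y -> gdist H (f x) (f y) <= c) ->
  forall x y, gdist H (f x) (f y) <= c * gdist G x y.
Proof.
move=> fc x y; have [p [Gp <- <-]] := gdist_walk G x y.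
elim: p x Gp => [|u p IHp] x /=; first by rewrite gdistxx.
case/andP=> xu Gp; rewrite mulnS.
by apply: leq_trans (gdist_triangle H (f u) _ _) _; rewrite leq_add ?fc ?IHp.
Qed.

Lemma gdist_symmetric (V : finType) (G : cgraph V) (x y : V) :
  gdist G x y = gdist G y x.
Proof.
wlog suff le_xy : x y / gdist G x y <= gdist G y x.
  by apply/eqP; rewrite eqn_leq !le_xy.
have [p [Gp <- <-]] := gdist_walk G y x.
(* The shortest walk from [y] to [x] is reversed: after its start [last y p] it reads
   [rev (belast y p)]. *)
rewrite -(size_belast y p) -size_rev.
have -> : gdist G (last y p) y = gdist G (last y p)
    (last (last y p) (rev (belast y p))).
  case: p {Gp} => //= u p; rewrite rev_cons last_rcons //.
apply: gdist_le_size; rewrite rev_path; apply: sub_path Gp => u v.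
by rewrite /= adj_sym.
Qed.

(** By induction on the radius: the ball of radius [k.+1] is covered by the closed unit balls around
    the points of the ball of radius [k], each of at most [d.+1] points. *)
Lemma card_ball (V : finType) (G : cgraph V) (d k : nat) (x : V) :
    (forall y, degree G y <= d) ->
  #|[set y | gdist G x y <= k]%SET| <= d.+1 ^ k.
Proof.
move=> degG; elim: k => [|k IHk].
  rewrite (_ : [set _ | _]%SET = [set x]%SET) ?cards1 //.
  apply/setP=> y; rewrite !inE leqn0.
  by apply/eqP/eqP => [/gdist_eq0|->]; rewrite ?gdistxx.
pose N y := (y |: [set z | G y z])%SET.
apply: (@leq_trans #|\bigcup_(y in [set y | gdist G x y <= k]) N y|)%SET.
  apply/subset_leq_card/fintype.subsetP => z; rewrite inE gdist_symmetric => xz.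
  have [->|zx] := eqVneq z x.
    by apply/bigcupP; exists x; rewrite !inE ?gdistxx ?eqxx.
  have [u zu lt_u] := gdist_step G zx.
  apply/bigcupP; exists u; last by rewrite !inE adj_sym zu orbT.
  by rewrite inE gdist_symmetric -ltnS (leq_trans lt_u xz).
apply: (@leq_trans (\sum_(y in [set y | gdist G x y <= k]) #|N y|))%SET.
  elim/big_rec2: _ => [|y m A _ le_Am]; first by rewrite cards0.
  by rewrite (leq_trans (leq_card_setU _ _)) // leq_add2l.
apply: (@leq_trans (\sum_(y in [set y | gdist G x y <= k]) d.+1))%SET.
  apply: leq_sum => y _; rewrite cardsU1.
  by rewrite -(add1n d) leq_add ?degG ?leq_b1.
by rewrite sum_nat_const expnS mulnC leq_mul2l IHk orbT.
Qed.

(** * Spanning forests of bounded depth *)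

Section SpanningForest.
Variables (V : finType) (G : cgraph V) (S : {set V}) (K : nat).
Hypothesis S_dense : forall v, exists2 s, s \in S & gdist G v s <= K.

(** Each vertex outside [S] steps to a neighbour closer to its nearest point of [S]. The depth is
    the distance to [S]; it drops because the nearest point of [v] also competes for [p v]. *)
Lemma spanning_forest :
  exists (p : V -> V) (depth : V -> nat),
    [/\ forall v, v \in S -> p v = v,
        forall v, v \notin S -> G v (p v) /\ depth (p v) < depth v
      & forall v, depth v <= K].
Proof.
have /choice[near nearP] v : exists s, [/\ s \in S, gdist G v s <= K
    & forall t, t \in S -> gdist G v s <= gdist G v t].
  have [s0 Ss0 le_s0] := S_dense v.
  case: (arg_minnP (gdist G v) Ss0) => s Ss min_s; exists s; split=> //.
  exact: leq_trans (min_s s0 Ss0) le_s0.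
have /choice[p pP] v : exists u, if v \in S then u = v else
    G v u /\ gdist G u (near v) < gdist G v (near v).
  have [nS _ _] := nearP v; case: (boolP (v \in S)) => [_|vS].
    by exists v.
  have v_near : v != near v by apply: contraNneq vS => ->.
  by have [u] := gdist_step G v_near; exists u.
exists p, (fun v => gdist G v (near v)); split=> v.
- by move=> vS; have := pP v; rewrite vS.
- move=> vS; have := pP v; rewrite (negPf vS) => -[vu lt_u]; split=> //.
  have [nS _ _] := nearP v; have [_ _ min_p] := nearP (p v).
  by apply: leq_ltn_trans lt_u; exact: min_p.
- by have [] := nearP v.
Qed.

Variables (p : V -> V) (depth : V -> nat).
Hypothesis p_root : forall v, v \in S -> p v = v.
Hypothesis p_parent :
  forall v, v \notin S -> G v (p v) /\ depth (p v) < depth v.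

Lemma iter_parent_root k v : depth v <= k -> iter k p v \in S.
Proof.
elim: k v => [|k IHk] v le_v.
  apply: contraLR (isT : 0 <= depth v) => /p_parent[_].
  by move: le_v; rewrite leqn0 => /eqP ->.
rewrite iterSr; have [vS|/p_parent[_ lt_p]] := boolP (v \in S).
  by rewrite p_root // iter_fix // p_root.
by apply: IHk; rewrite -ltnS (leq_trans lt_p).
Qed.

Lemma gdist_iter_parent k v : gdist G v (iter k p v) <= k.
Proof.
elim: k v => [|k IHk] v; first by rewrite gdistxx.
rewrite iterSr; have [vS|/p_parent[vp _]] := boolP (v \in S).
  by rewrite p_root // (leq_trans (IHk v)).
apply: leq_trans (gdist_triangle G (p v) _ _) _.
by rewrite -add1n leq_add ?gdist_adj.
Qed.

Definition forest_edges : {set {set V}} :=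
  [set [set v; p v] | v in ~: S]%SET.

Lemma forest_edges_sub : forest_edges \subset edges G.
Proof.
apply/fintype.subsetP => e /imsetP[v]; rewrite inE => /p_parent[vp _] ->.
by apply/imsetP; exists (v, p v); rewrite ?inE.
Qed.

(** A forest edge determines its child, the endpoint of larger depth, so distinct non-roots give
    distinct edges. *)
Lemma card_forest_edges : #|forest_edges| = #|~: S|%SET.
Proof.
apply: card_in_imset => u v; rewrite !inE.
move=> /p_parent[_ lt_u] /p_parent[_ lt_v].
move=> /setP eq_uv; have := eq_uv u; have := eq_uv v.
rewrite !inE !eqxx /= => /orP[/eqP->//|/eqP vpu] /esym/orP[/eqP->//|/eqP upv].
by move: lt_u lt_v; rewrite -vpu -upv => /ltnW; rewrite leqNgt => /negPf ->.
Qed.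

End SpanningForest.

Lemma leq_card_vertices_edges (V : finType) (G : cgraph V) :
  #|V| <= #|edges G| + 1.
Proof.
have [x0 _] := card_gt0P (vertices_gt0 G).
have [v|p [depth [_ p_parent _]]] := @spanning_forest V G [set x0]%SET #|V|.
  exists x0; first by rewrite inE.
  (* A walk without repeated vertices has fewer than [#|V|] edges, which justifies [#|V|] as depth
     bound for a single root. *)
  have /connectP[q Gq qx0] := adj_connected G v x0.
  rewrite qx0; case/shortenP: Gq => q' Gq' Uq' _.
  apply: leq_trans (gdist_le_size Gq') _.
  by apply: leq_trans (max_card (mem (v :: q'))); rewrite (card_uniqP Uq') /=.
have := subset_leq_card (forest_edges_sub p_parent).
rewrite (card_forest_edges p_parent) cardsCs finset.setCK cards1; lia.
Qed.

(** * Coarse maps with natural constants *)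

Definition coarse_map (a : nat) (V W : finType) (G : cgraph V) (H : cgraph W)
    (f : V -> W) : Prop :=
  [/\ forall x y, gdist H (f x) (f y) <= a * gdist G x y + a,
      forall x y, gdist G x y <= a * gdist H (f x) (f y) + a
    & forall z, exists x, gdist H z (f x) <= a].

(** A quasi-inverse sends [z] to any [x] with [f x] within [a] of [z]. The constant dominates the
    three additive errors [2 * a * a + a], [3 * a] and [a * a + a]. *)
Lemma coarse_map_inverse a (V W : finType) (G : cgraph V) (H : cgraph W)
    (f : V -> W) :
  coarse_map a G H f -> exists g, coarse_map (3 * a * a + 3 * a) H G g.
Proof.
move=> [fG fH /choice[g gP]]; exists g.
have gP' z : gdist H (f (g z)) z <= a by rewrite gdist_symmetric.
split=> [x y|x y|z].
- apply: leq_trans (fH _ _) _.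
  have := gdist_triangle H x (f (g x)) (f (g y)).
  have := gdist_triangle H y x (f (g y)); have := gP y; have := gP' x.
  nia.
- have := gdist_triangle H (f (g x)) x y.
  have := gdist_triangle H (f (g y)) (f (g x)) y.
  have := fG (g x) (g y); have := gP x; have := gP' y.
  nia.
- exists (f z); apply: leq_trans (fH _ _) _; have := gP (f z); nia.
Qed.

(** Two points of one fibre are at distance at most [a], so each fibre lies in a ball of radius
    [a]. *)
Lemma card_coarse_map_fibers a d (V W : finType) (G : cgraph V) (H : cgraph W)
    (f : V -> W) :
    coarse_map a G H f -> (forall x, degree G x <= d) ->
  #|V| <= d.+1 ^ a * #|W|.
Proof.
move=> [_ fH _] degG; rewrite -sum1_card (partition_big f predT) //=.
rewrite mulnC -sum_nat_const; apply: leq_sum => w _.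
rewrite sum1_card.
have [-> //|/card_gt0P[x /eqP xw]] := posnP #|[pred x | f x == w]|.
apply: leq_trans (card_ball a x degG).
apply/subset_leq_card/fintype.subsetP => y /eqP yw; rewrite inE.
by apply: leq_trans (fH x y) _; rewrite xw yw gdistxx muln0.
Qed.

(** * Transfer of a single graph along a coarse map *)

Section Transfer.
Variables (a : nat) (V W : finType) (G : cgraph V) (H : cgraph W).
Variable phi : V -> W.
Hypothesis phi_coarse : coarse_map a G H phi.

(** On the image of [phi] the quasi-inverse is taken to be an exact section; [g (phi x)] is then a
    representative of the fibre of [x]. *)
Lemma coarse_section :
  exists g : W -> V, (forall w, gdist H w (phi (g w)) <= a) /\
                     (forall x, phi (g (phi x)) = phi x).
Proof.
have [_ _ phi_dense] := phi_coarse.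
have /choice[g gP] w : exists x, gdist H w (phi x) <= a /\
    ((exists y, phi y = w) -> phi x = w).
  have [[x xw]|nw] := pselect (exists y, phi y = w).
    by exists x; rewrite xw gdistxx.
  by have [x] := phi_dense w; exists x.
exists g; split=> [w|x]; first by have [] := gP w.
by have [_] := gP (phi x); apply; exists x.
Qed.

Lemma transfer_graph : exists H' : cgraph W,
  [/\ forall u w, gdist H u w <= (2 * a * a + 2 * a + 2) * gdist H' u w,
      forall u w, gdist H' u w <= (2 * a * a + 2 * a + 2) * gdist H u w
    & #|edges H'| + #|V| <= #|edges G| + #|W|].
Proof.
have [phiH phiG _] := phi_coarse.
have [g [g_near phiK]] := coarse_section.
pose S := [set x | g (phi x) == x]%SET.
have gS x : g (phi x) \in S by rewrite inE phiK.
have S_dense v : exists2 s, s \in S & gdist G v s <= a.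
  exists (g (phi v)) => //; apply: leq_trans (phiG _ _) _.
  by rewrite phiK gdistxx muln0.
have [p [depth [p_root p_parent depth_le]]] := spanning_forest S_dense.
(* Depths are at most [a], so [a] steps reach the root, and surplus steps stay there. The map [f]
   contracts each tree and transports it to [W]. *)
pose root v := iter a p v; pose f v := phi (root v).
have rootS v : root v \in S.
  exact: (iter_parent_root p_root p_parent (depth_le v)).
have root_near v : gdist G v (root v) <= a.
  exact: (gdist_iter_parent p_root p_parent).
have fS v : v \in S -> f v = phi v.
  by move=> /p_root pv; rewrite /f /root iter_fix.
have fgS w : phi (g w) = f (g (phi (g w))) by rewrite fS // phiK.
have f_parent v : f (p v) = f v.
  by rewrite /f /root -iterSr iterS p_root.
(* For [u] in the image of [phi] the second disjunct is the loop at [u], which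
   is discarded below: only vertices outside the image get a new edge. *)
pose t u w := [exists e : V * V, [&& G e.1 e.2, f e.1 == u & f e.2 == w]]
  || (w == phi (g u)).
pose H'rel u w := (u != w) && (t u w || t w u).
have H'sym : symmetric H'rel by move=> u w; rewrite /H'rel eq_sym orbC.
have H'irr : irreflexive H'rel by move=> u; rewrite /H'rel eqxx.
have H'star w : (phi (g w) == w) || H'rel w (phi (g w)).
  by rewrite /H'rel /t eqxx orbT eq_sym; case: eqP.
have H'edge x y : G x y -> (f x == f y) || H'rel (f x) (f y).
  move=> xy; rewrite /H'rel; case: eqP => //= _.
  apply/orP; left; apply/orP; left; apply/existsP; exists (x, y).
  by rewrite xy !eqxx.
(* Every vertex is equal or adjacent to a point of the image of [phi], and [f] carries walks of [G]
   to walks that may pause. *)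
have H'con u w : connect H'rel u w.
  have conC := sym_connect_sym H'sym.
  have con_star v : connect H'rel v (phi (g v)).
    by have /orP[/eqP<-|/connect1//] := H'star v; rewrite phiK connect0.
  have con_f x y : connect H'rel (f x) (f y).
    have /connectP[q Gq ->] := adj_connected G x y.
    elim: q x Gq => [|z q IHq] x /=; first by rewrite connect0.
    case/andP=> /H'edge/orP[/eqP->|/connect1 xz] /IHq //.
    exact: connect_trans.
  apply: connect_trans (con_star u) _; rewrite conC.
  apply: connect_trans (con_star w) _.
  by rewrite (fgS u) (fgS w) con_f.
pose H' := @CGraph W H'rel H'sym H'irr (vertices_gt0 H) H'con.
have H'starD w : gdist H' w (phi (g w)) <= 1.
  by have /orP[/eqP->|/(@gdist_adj _ H')//] := H'star w; rewrite gdistxx.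
have H'edgeD x y : G x y -> gdist H' (f x) (f y) <= 1.
  by case/H'edge/orP=> [/eqP->|/(@gdist_adj _ H')//]; rewrite gdistxx.
exists H'; split.
- have tH u w : t u w -> gdist H u w <= 2 * a * a + 2 * a + 2.
    case/orP=> [/existsP[[x y]/= /and3P[xy /eqP<- /eqP<-]]|/eqP->]; last first.
      by apply: leq_trans (g_near u) _; nia.
    (* Going from root to root through the edge costs [a + 1 + a]; [phi] turns this into at most
       [a * (2 * a + 1) + a]. *)
    have le_root : gdist G (root x) (root y) <= 2 * a + 1.
      have := gdist_triangle G x (root x) (root y).
      have := gdist_triangle G y x (root y).
      have := gdist_adj xy; have := root_near x; have := root_near y.
      rewrite (gdist_symmetric _ (root x) x); lia.
    apply: leq_trans (phiH _ _) _.
    have := leq_mul (leqnn a) le_root; nia.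
  apply: (@gdist_lipschitz _ _ H' H id) => u w /andP[_ /orP[/tH//|/tH]].
  by rewrite gdist_symmetric.
- apply: (@gdist_lipschitz _ _ H H' id) => u w uw.
  (* These representatives have images within [a] of [u] and [w]. Their distance is bounded in [G],
     [f] does not increase it, and the two attaching edges at [u] and [w] account for the final
     [+ 2]. *)
  set x := g (phi (g u)); set y := g (phi (g w)).
  have le_phi : gdist H (phi x) (phi y) <= 2 * a + 1.
    rewrite !phiK; have := gdist_triangle H u (phi (g u)) (phi (g w)).
    have := gdist_triangle H w u (phi (g w)).
    have := gdist_adj uw; have := g_near u; have := g_near w.
    rewrite (gdist_symmetric _ (phi (g u)) u); lia.
  have le_xy : gdist G x y <= a * (2 * a + 1) + a.
    by apply: leq_trans (phiG _ _) _; rewrite leq_add2r leq_mul2l le_phi orbT.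
  have := gdist_triangle H' (f x) u w.
  have := gdist_triangle H' (f y) (f x) w.
  have := gdist_lipschitz H'edgeD x y.
  rewrite /x /y -(fgS u) -(fgS w) (gdist_symmetric H' (phi (g w)) w).
  rewrite mul1n -/x -/y.
  have := H'starD u; have := H'starD w; nia.
(* An edge of [H'] is the image of a non-forest edge of [G] or attaches a vertex outside [phi @: S].
   This gives at most [#|edges G| - (#|V| - #|S|)] plus [#|W| - #|S|] edges, and [#|S|] cancels. *)
- pose inner := forest_edges S p.
  pose stars := [set [set w; phi (g w)] | w in ~: (phi @: S)]%SET.
  pose outer := [set f @: (e : {set V}) | e in edges G :\: inner]%SET.
  have edges_sub : edges H' \subset (outer :|: stars)%SET.
    have tsub u w : u != w -> t u w -> [set u; w]%SET \in (outer :|: stars)%SET.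
      move=> uw; rewrite finset.in_setU.
      case/orP=> [/existsP[[x y]/= /and3P[xy /eqP fx /eqP fy]]|/eqP wE].
        apply/orP; left; apply/imsetP; exists [set x; y]%SET; last first.
          by rewrite imsetU1 imset_set1 fx fy.
        rewrite finset.in_setD; apply/andP; split; last first.
          by apply/imsetP; exists (x, y); rewrite ?inE.
        (* A forest edge cannot produce an edge of [H']: [f] identifies its endpoints, whereas [u]
           and [w] differ. *)
        apply/imsetP => -[v _ /setP xyE].
        have : f x = f y.
          have := xyE x; have := xyE y; rewrite !inE !eqxx orbT /=.
          by do 2![case/esym/orP=> /eqP ->]; rewrite ?f_parent.
        by rewrite fx fy; apply/eqP.
      apply/orP; right; apply/imsetP; exists u; last by rewrite wE.
      rewrite inE; apply: contra uw => /imsetP[x _ ux].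
      by rewrite wE ux phiK.
    apply/fintype.subsetP => e /imsetP[[u w]]; rewrite inE /=.
    move=> /andP[uw tuw] ->.
    case/orP: tuw => /tsub tuw; first exact: tuw.
    by rewrite finset.setUC tuw // eq_sym.
  have le_edges := leq_trans (subset_leq_card edges_sub) (leq_card_setU _ _).
  have le_outer : #|outer| <= #|edges G :\: inner|%SET.
    exact: leq_imset_card.
  have le_stars : #|stars| <= #|~: (phi @: S)|%SET by exact: leq_imset_card.
  have le_inner := subset_leq_card (forest_edges_sub p_parent).
  have card_inner := card_forest_edges p_parent.
  have card_outer := cardsDS (forest_edges_sub p_parent).
  have card_phiS : #|phi @: S|%SET = #|S|.
    apply: card_in_imset => x y; rewrite !inE => /eqP gx /eqP gy xy.
    by rewrite -gx -gy xy.
  have cardV := cardsC S; have cardW := cardsC (phi @: S)%SET.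
  (* [lia] identifies cardinals syntactically, up to this coercion. *)
  rewrite /reverse_coercion in le_edges le_outer le_stars le_inner card_inner
    card_outer *.
  rewrite -/inner in le_inner card_inner card_outer.
  lia.
Qed.

End Transfer.

(** * From real to natural constants, and from graphs to sequences *)

Lemma coarsely_equivalent_coarse_map (R : realType) (V W : nat -> finType)
    (G : graph_sequence V) (H : graph_sequence W) :
    coarsely_equivalent R G H ->
  exists a, forall n, exists phi, coarse_map a (G n) (H n) phi.
Proof.
(* Clearing the denominator in the lower bound creates the error [A * A]; the chosen natural number
   exceeds both this and [A]. *)
move=> [A A0 GH]; exists (Num.truncn (A * A + A)%R).+1 => n.
have [phi [phi_lip phi_dense]] := GH n; exists phi.
have ltA : (A * A + A < (Num.truncn (A * A + A)%R).+1%:R)%R.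
  exact: truncnS_gt.
set a := _.+1 in ltA *.
have AA0 : (0 < A * A)%R by rewrite mulr_gt0.
split=> [x y|x y|z].
- rewrite -(ler_nat R) natrD natrM; have [_ le_xy] := phi_lip x y.
  apply: (Order.POrderTheory.le_trans le_xy).
  by rewrite lerD ?ler_wpM2r //; lra.
- rewrite -(ler_nat R) natrD natrM; have [le_xy _] := phi_lip x y.
  move: le_xy; rewrite lerBlDr ler_pdivrMr // mulrDl => le_xy.
  apply: (Order.POrderTheory.le_trans le_xy).
  rewrite lerD ?[(_%:R * A)%R]mulrC ?ler_wpM2r //; lra.
- have [x le_x] := phi_dense z; exists x; rewrite -(ler_nat R).
  by apply: (Order.POrderTheory.le_trans le_x); lra.
Qed.

Definition lipschitz_equivalent (l : nat) (V : finType) (G H : cgraph V) :=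
  forall x y, gdist G x y <= l * gdist H x y /\ gdist H x y <= l * gdist G x y.

Lemma bilip_equivalentP (R : realType) (V : nat -> finType)
    (G H : graph_sequence V) :
  bilip_equivalent R G H <->
  exists l, forall n, lipschitz_equivalent l (G n) (H n).
Proof.
split=> [[L L0 GH]|[l GH]].
  exists (Num.truncn L).+1 => n x y; have [le1 le2] := GH n x y.
  have ltL : (L < (Num.truncn L).+1%:R)%R by exact: truncnS_gt.
  rewrite -!(ler_nat R) !natrM; split.
    move: le1; rewrite ler_pdivrMr // mulrC => le1.
    by apply: (Order.POrderTheory.le_trans le1); rewrite ler_wpM2r // ltW.
  by apply: (Order.POrderTheory.le_trans le2); rewrite ler_wpM2r // ltW.
(* The successor keeps the constant positive even when [l] is [0]. *)
exists l.+1%:R%R => // n x y; have [le1 le2] := GH n x y.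
rewrite ler_pdivrMr // -!natrM !ler_nat; nia.
Qed.

(** The neighbours of [x] in [H] lie in the ball of radius [l] around [x] in [G]. This provides the
    degree bound that makes the transferred graphs a graph sequence. *)
Lemma lipschitz_bounded_degree l d (V : finType) (G H : cgraph V) :
    lipschitz_equivalent l H G -> (forall x, degree G x <= d) ->
  forall x, degree H x <= d.+1 ^ l.
Proof.
move=> HG degG x; apply: leq_trans (card_ball l x degG).
apply/subset_leq_card/fintype.subsetP => y; rewrite !inE => /gdist_adj xy.
have [_ le_xy] := HG x y; apply: leq_trans le_xy _.
by rewrite -[leqRHS]muln1 leq_mul2l xy orbT.
Qed.

Lemma coarse_map_lipschitz a l (V W : finType) (G G' : cgraph V)
    (H : cgraph W) (phi : V -> W) :
    coarse_map a G H phi -> lipschitz_equivalent l G' G ->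
  coarse_map (l * a + a) G' H phi.
Proof.
move=> [phiH phiG phi_dense] GG'; split=> [x y|x y|z].
- by have := phiH x y; have [_] := GG' x y; nia.
- by have := phiG x y; have [+ _] := GG' x y; nia.
- by have [x] := phi_dense z; exists x; lia.
Qed.

Lemma transfer_graph_sequence (R : realType) (V W : nat -> finType)
    (G G' : graph_sequence V) (H : graph_sequence W) a :
    (forall n, exists phi, coarse_map a (G n) (H n) phi) ->
    bilip_equivalent R G' G ->
  exists2 H' : graph_sequence W, bilip_equivalent R H' H &
    forall n, #|edges (H' n)| + #|V n| <= #|edges (G' n)| + #|W n|.
Proof.
move=> GH /bilip_equivalentP[l GG'].
have [L transfer_n] : exists L, forall n, exists H' : cgraph (W n),
    lipschitz_equivalent L H' (H n) /\
    #|edges H'| + #|V n| <= #|edges (G' n)| + #|W n|.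
  (* The constant found by unification depends only on [a] and [l], hence is uniform in [n]. *)
  eexists => n; have [phi phi_coarse] := GH n.
  have [H' [H'1 H'2 H'3]] :=
    transfer_graph (coarse_map_lipschitz phi_coarse (GG' n)).
  by exists H'; split.
pose H' n := sval (cid (transfer_n n)).
have H'P n : lipschitz_equivalent L (H' n) (H n) /\
    #|edges (H' n)| + #|V n| <= #|edges (G' n)| + #|W n|.
  exact: svalP (cid (transfer_n n)).
have H'deg : exists d, forall n x, degree (H' n) x <= d.
  have [d degH] := bounded_degree H; exists (d.+1 ^ L) => n.
  by apply: lipschitz_bounded_degree (degH n); have [] := H'P n.
exists (GraphSequence H'deg (vertices_cvg H)) => [|n]; last by have [] := H'P n.
by apply/bilip_equivalentP; exists L => n; have [] := H'P n.
Qed.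

(** * Lower limits, edge numbers and cost *)

Section LimInf.
Local Open Scope ereal_scope.
Variables (R : realType) (u : nat -> \bar R).

Lemma limn_einf_ereal_sup : limn_einf u = ereal_sup (range (einfs u)).
Proof. by rewrite limn_einf_lim; apply/cvg_lim/cvg_einfs_sup. Qed.

Lemma limn_einf_lt x N : limn_einf u < x -> exists2 n, (N <= n)%N & u n < x.
Proof.
rewrite limn_einf_ereal_sup => lt_x.
have : einfs u N < x.
  by apply: le_lt_trans lt_x; apply: ereal_sup_ubound; exists N.
by move=> /ereal_inf_lt[_ [n /= Nn <-]]; exists n.
Qed.

Lemma limn_einf_le x :
  (forall N, exists2 n, (N <= n)%N & u n <= x) -> limn_einf u <= x.
Proof.
move=> le_x; rewrite limn_einf_ereal_sup; apply: ge_ereal_sup => _ [N _ <-].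
have [n Nn] := le_x N; apply: le_trans.
by apply: ereal_inf_lbound; exists n.
Qed.

End LimInf.

(** Connectedness gives a ratio of at least [1 - 1 / #|V n|], and [#|V n|] tends to infinity. *)
Lemma edge_number_ge1 (R : realType) (V : nat -> finType)
  (G : graph_sequence V) : (1 <= edge_number R G)%E.
Proof.
apply/lee_addgt0Pr => e e0; rewrite -leeBlDr // leNgt; apply/negP.
pose M := (Num.truncn (e^-1)%R).+1.
have /cvgnyPge/(_ M)[N _ leM] := vertices_cvg G.
move=> /(@limn_einf_lt _ _ _ N)[n Nn]; apply/negP; rewrite -leNgt.
have V0 : (0 < #|V n|%:R :> R)%R by rewrite ltr0n (vertices_gt0 (G n)).
rewrite -EFinB lee_fin ler_pdivlMr // mulrBl mul1r.
have : (e^-1 <= #|V n|%:R)%R.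
  apply: (@Order.POrderTheory.le_trans _ _ M%:R%R).
    exact/ltW/truncnS_gt.
  by rewrite ler_nat; exact: leM.
rewrite -[X in (X <= _)%R]mul1r ler_pdivrMr // mulrC.
have := leq_card_vertices_edges (G n).
by rewrite -(ler_nat R) natrD; lra.
Qed.

Lemma cost_ge1 (R : realType) (V : nat -> finType) (G : graph_sequence V) :
  (1 <= cost R G)%E.
Proof.
by apply: le_ereal_inf_tmp => _ [G' _ <-]; exact: edge_number_ge1.
Qed.

Lemma cost_transfer (R : realType) (V W : nat -> finType)
    (G : graph_sequence V) (H : graph_sequence W) a :
    (forall n, exists phi, coarse_map a (G n) (H n) phi) ->
  cost R G = 1%E -> cost R H = 1%E.
Proof.
move=> GH costG; apply/eqP; rewrite eq_le cost_ge1 andbT.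
apply/lee_addgt0Pr => e e0.
have [d degG] := bounded_degree G.
pose C : R := (d.+1 ^ a)%:R%R.
have C0 : (0 < C)%R by rewrite ltr0n expn_gt0.
(* The slack [e / C] compensates for [#|V n| <= C * #|W n|]: an excess of edges over vertices below
   [e / C * #|V n|] is below [e * #|W n|]. *)
have : (cost R G < 1 + (e / C)%:E)%E.
  by rewrite costG lteDl // lte_fin divr_gt0.
move=> /ereal_inf_lt[_ [G' /= GG' <-]] ltG'.
have [H' HH' edgesH'] := transfer_graph_sequence GH GG'.
apply: (@Order.POrderTheory.le_trans _ _ (edge_number R H')).
  by apply: ereal_inf_lbound; exists H'.
(* The comparison is made index by index, so the infinitely many good indices of [G'] serve for [H']
   as well. *)
apply: limn_einf_le => N; have [n Nn ltn] := limn_einf_lt N ltG'.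
exists n => //.
have V0 : (0 < #|V n|%:R :> R)%R by rewrite ltr0n (vertices_gt0 (G n)).
have W0 : (0 < #|W n|%:R :> R)%R by rewrite ltr0n (vertices_gt0 (H n)).
have [phi phi_coarse] := GH n.
have leV : (#|V n|%:R <= C * #|W n|%:R)%R.
  by rewrite -natrM ler_nat (card_coarse_map_fibers phi_coarse (degG n)).
move: (edgesH' n); rewrite -(ler_nat R) !natrD => le_edges.
move: ltn; rewrite -!EFinD lte_fin lee_fin ltr_pdivrMr // ler_pdivrMr //.
move=> lt_edges.
have : (e / C * #|V n|%:R <= e * #|W n|%:R)%R.
  by rewrite mulrAC ler_pdivrMr // -mulrA ler_pM2l // [(_ * C)%R]mulrC.
lra.
Qed.

Theorem theorem0p2 (R : realType) (V W : nat -> finType)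
    (G : graph_sequence V) (H : graph_sequence W)
    (GH : coarsely_equivalent R G H) :
  cost R G = 1%E <-> cost R H = 1%E.
Proof.
have [a coarseGH] := coarsely_equivalent_coarse_map GH.
split; first exact: cost_transfer coarseGH.
(* The converse runs the same transfer along quasi-inverses, whose constant is again independent of
   [n]. *)
apply: cost_transfer => n; have [phi] := coarseGH n.
exact: coarse_map_inverse.
Qed.
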